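(* Let $n$ be a positive integer, let $H$ be a (possibly infinite-dimensional) complex Hilbert space, and let $Q$ be a projection of rank $1$ in the set $\mathcal{M}_n$ of $n\times n$ complex matrices. If $M\in\mathcal{X}(H)$, then $\nu_n(M)\geq\nu(Q)$.
   Context: $\mathcal{B}(H)$ is the set of bounded linear operators on $H$, and $\|\cdot\|$ is the operator norm (on $\mathcal{M}_n$, the one induced by the Euclidean norm on $\mathbb{C}^n$). A projection is a hermitian (self-adjoint) idempotent. For self-adjoint operators $A,B$, $A\leq B$ means that $B-A$ is positive semidefinite. $\mathcal{X}(H)$ denotes the set of operators $M\in\mathcal{B}(H)$ for which there is a nonzero projection $P\in\mathcal{B}(H)$ satisfying $PMP=M$ and $M^*M\geq P$. For $A\in\mathcal{B}(H)$, $\nu_n(A)=\inf\{\|A-N\| : N\in\mathcal{B}(H),\ N^n=0\}$. For $A\in\mathcal{M}_n$, $\nu(A)=\inf\{\|A-N\| : N\in\mathcal{M}_n \text{ nilpotent}\}$. The value $\nu(Q)$ does not depend on the choice of the rank-one projection $Q\in\mathcal{M}_n$; it is known (MacDonald, 1995) that $\nu(Q)=\frac12\sec\frac{\pi}{n+2}$. *)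

(* Defs.v *)
From HB Require Import structures.
From mathcomp Require Import all_boot all_order all_algebra.
From mathcomp Require Import complex ring.
From mathcomp Require Import all_classical all_reals all_analysis.

Set Implicit Arguments.
Unset Strict Implicit.
Unset Printing Implicit Defensive.

Import Order.TTheory GRing.Theory Num.Theory.
Import numFieldNormedType.Exports.

Local Open Scope classical_set_scope.
Local Open Scope complex_scope.
Local Open Scope sesquilinear_scope.
Local Open Scope ring_scope.

(* The inner product is linear in its first argument and conjugate-linear in
   its second one. *)
HB.mixin Record NormedModule_isHilbert (R : realType) H
    of CompleteNormedModule R[i] H := {
  inner : {dot H for (@Num.conj R[i])} ;
  inner_norm : forall x : H, inner x x = `|x| ^+ 2
}.

#[short(type="hilbertType")]
HB.structure Definition Hilbert (R : realType) :=
  {H of CompleteNormedModule R[i] H & NormedModule_isHilbert R H}.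

Section BoundedOperators.
Variables (R : realType) (H : hilbertType R).

Record bop := Bop {
  bop_fun :> H -> H ;
  bop_linear : linear bop_fun ;
  bop_bounded : bounded_near bop_fun (nbhs (0 : H)) }.

HB.instance Definition _ := gen_eqMixin bop.
HB.instance Definition _ := gen_choiceMixin bop.
HB.instance Definition _ (A : bop) :=
  GRing.isLinear.Build R[i] H H *:%R (bop_fun A) (bop_linear A).

Lemma bopP (A B : bop) : A =1 B -> A = B.
Proof.
case: A B => [f lf bf] [g lg bg] /= /funext fg; subst g.
by rewrite (Prop_irrelevance lf lg) (Prop_irrelevance bf bg).
Qed.

Lemma bop_continuous (A : bop) : continuous A.
Proof. exact/linear_bounded_continuous/bop_bounded. Qed.

Definition bop_of (f : {linear H -> H}) (cf : continuous f) : bop :=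
  Bop (fun a => linearP f a) ((linear_bounded_continuous f).2 cf).

Fact bop0_continuous : continuous (\0%R : H -> H).
Proof. by move=> x; exact: cvg_cst. Qed.
Fact bopN_continuous (A : bop) : continuous (\- A : H -> H).
Proof. by move=> x; exact/continuousN/bop_continuous. Qed.
Fact bopD_continuous (A B : bop) : continuous (A \+ B : H -> H).
Proof. by move=> x; apply: continuousD; exact: bop_continuous. Qed.
Fact bop1_continuous : continuous (idfun : H -> H).
Proof. by move=> x; exact: cvg_id. Qed.
Fact bopM_continuous (A B : bop) : continuous (A \o B : H -> H).
Proof. by move=> x; apply: continuous_comp; exact: bop_continuous. Qed.

Definition bop0 := bop_of bop0_continuous.
Definition bopN A := bop_of (@bopN_continuous A).
Definition bopD A B := bop_of (@bopD_continuous A B).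
Definition bop1 := bop_of bop1_continuous.
Definition bopM A B := bop_of (@bopM_continuous A B).

Fact bopDA : associative bopD.
Proof. by move=> A B C; apply: bopP => x /=; rewrite addrA. Qed.
Fact bopDC : commutative bopD.
Proof. by move=> A B; apply: bopP => x /=; rewrite addrC. Qed.
Fact bop0D : left_id bop0 bopD.
Proof. by move=> A; apply: bopP => x /=; rewrite add0r. Qed.
Fact bopND : left_inverse bop0 bopN bopD.
Proof. by move=> A; apply: bopP => x /=; rewrite addNr. Qed.

HB.instance Definition _ := GRing.isZmodule.Build bop bopDA bopDC bop0D bopND.

Fact bopMA : associative bopM.
Proof. by move=> A B C; exact: bopP. Qed.
Fact bop1M : left_id bop1 bopM.
Proof. by move=> A; exact: bopP. Qed.
Fact bopM1 : right_id bop1 bopM.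
Proof. by move=> A; exact: bopP. Qed.
Fact bopMDl : left_distributive bopM bopD.
Proof. by move=> A B C; exact: bopP. Qed.
Fact bopMDr : right_distributive bopM bopD.
Proof. by move=> A B C; apply: bopP => x /=; rewrite linearD. Qed.

HB.instance Definition _ :=
  GRing.Zmodule_isPzRing.Build bop bopMA bop1M bopM1 bopMDl bopMDr.

End BoundedOperators.

Section Adjoint.
Variables (R : realType) (H : hilbertType R).
Local Notation C := R[i].
Local Notation "''[' u , v ]" := (@inner R H u v).
Implicit Types (u v x y z : H) (A B : bop H).

Lemma innerC u v : '[u, v] = ('[v, u])^*%R.
Proof. by rewrite [LHS]hermC /= expr0 mul1r. Qed.

Lemma inner_eq0P x : (forall y, '[y, x] = 0) -> x = 0.
Proof. by move=> /(_ x)/eqP; rewrite dnorm_eq0 => /eqP. Qed.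

Lemma inner_residual u v : v != 0 ->
  let w := u - ('[u, v] / '[v, v]) *: v in
  `|w| ^+ 2 = `|u| ^+ 2 - `|'[u, v]| ^+ 2 / `|v| ^+ 2.
Proof.
move=> v0 w; have nv0 : `|v| ^+ 2 != 0 by rewrite expf_neq0// normr_eq0.
rewrite -!inner_norm /w dnormB dnormZ linearZr_LR /= inner_norm.
set a := '[u, v]; set N := `|v| ^+ 2 in nv0 *.
have NR : N^* = N by rewrite conj_Creal// rpredX// normr_real.
have aNJ : (a / N)^*%R = a^*%R / N by rewrite rmorphM/= fmorphV/= NR.
rewrite aNJ !rmorphM/= fmorphV/= NR conjCK normrM exprMn normfV.
rewrite (ger0_norm (_ : 0 <= N)) ?exprn_ge0// normCK.
by field.
Qed.

Lemma inner_CauchySchwarz u v : `|'[u, v]| <= `|u| * `|v|.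
Proof.
have [->|v0] := eqVneq v 0; first by rewrite linear0r normr0 mulr_ge0.
rewrite -(@ler_pXn2r _ 2) ?nnegrE ?mulr_ge0// exprMn.
rewrite -ler_pdivrMr ?exprn_gt0 ?normr_gt0// -subr_ge0.
by rewrite -inner_residual// exprn_ge0.
Qed.

Lemma parallelogram u v :
  `|u + v| ^+ 2 + `|u - v| ^+ 2 = 2 * (`|u| ^+ 2 + `|v| ^+ 2).
Proof. by rewrite -!inner_norm dnormD dnormB; ring. Qed.

Lemma inf_sqr_norm (S : set H) : S !=set0 -> exists m : C,
  (forall v, S v -> m <= `|v| ^+ 2) /\
  (forall e, 0 < e -> exists2 v, S v & `|v| ^+ 2 < m + e).
Proof.
move=> [v0 Sv0]; pose q v := complex.Re (`|v| ^+ 2).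
have qE v : (q v)%:C%C = `|v| ^+ 2 by rewrite RRe_real// rpredX// normr_real.
have hq : has_inf (q @` S).
  split; first by exists (q v0), v0.
  by exists 0 => _ [v _ <-]; rewrite -lecR qE exprn_ge0.
exists (inf (q @` S))%:C%C; split=> [v Sv|e e0].
  by rewrite -qE lecR; apply: ge_inf; [exact: hq.2|exists v].
have eE : e = (complex.Re e)%:C%C by rewrite RRe_real// gtr0_real.
have Re0 : 0 < complex.Re e by rewrite -ltcR -eE.
have [_ [v Sv <-] qv] := inf_adherent Re0 hq.
by exists v => //; rewrite -qE eE -rmorphD/= ltcR.
Qed.

Lemma riesz (f : {scalar H}) (c : C) : 0 <= c -> (forall x, `|f x| <= c * `|x|) ->
  exists z, forall x, f x = '[x, z].
Proof.
move=> c0 fc; have [f0|/existsNP[w /eqP fw0]] := pselect (forall x, f x = 0).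
  by exists 0 => x; rewrite linear0r.
pose S := [set v | f v = 1].
have S0 : S !=set0 by exists ((f w)^-1 *: w); rewrite /S/= linearZ/= mulVf.
have [m [lem ltm]] := inf_sqr_norm S0.
pose Se (e : C) := [set v | f v = 1 /\ `|v| ^+ 2 < m + e].
pose F : set_system H := filter_from [set e : C | 0 < e] Se.
have FF : ProperFilter F.
  apply: filter_from_proper => [|e /= /ltm[v Sv ve]]; last by exists v.
  apply: filter_from_filter; first by exists 1 => /=.
  move=> e1 e2 /= e10 e20; exists (Num.min e1 e2) => /=.
    by rewrite /Num.min; case: ifP.
  have cmp : e1 >=< e2 by rewrite real_comparable// gtr0_real.
  move=> v [fv ve]; split; split=> //; apply: lt_le_trans ve _.
    by rewrite lerD2l comparable_ge_min// lexx.
  by rewrite lerD2l comparable_ge_min// lexx orbT.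
have Fcauchy : cauchy F.
  apply: cauchy_exP => e e0; pose d := e ^+ 2 / 4.
  have d0 : 0 < d by rewrite divr_gt0// exprn_gt0.
  have [u Su ud] := ltm _ d0; exists u; exists d => // v [fv vd].
  rewrite -ball_normE /ball_ /= -(@ltr_pXn2r _ 2) ?nnegrE// ?ltW//.
  have : 4 * m <= `|u + v| ^+ 2.
    have := lem (2^-1 *: (u + v)).
    rewrite /S/= linearZ/= linearD/= Su fv.
    rewrite normrZ exprMn ger0_norm ?invr_ge0// exprVn -natrX ler_pdivlMl//.
    by apply; rewrite (_ : 1 + 1 = 2)// mulVf.
  move=> h; rewrite -(ltrD2l (`|u + v| ^+ 2)) parallelogram.
  have h2 : `|u| ^+ 2 + `|v| ^+ 2 < (m + d) + (m + d) by exact: ltrD.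
  have : 2 * (`|u| ^+ 2 + `|v| ^+ 2) < 2 * ((m + d) + (m + d)).
    by rewrite ltr_pM2l.
  move/lt_le_trans; apply.
  rewrite (_ : 2 * (m + d + (m + d)) = 4 * m + e ^+ 2); first by rewrite lerD2r.
  by rewrite /d; field.
have /cvg_ex[z Fz] : cvg F by exact: cauchy_cvg.
have near_z e d : 0 < e -> 0 < d ->
    exists v, [/\ f v = 1, `|v| ^+ 2 < m + e & `|z - v| < d].
  move=> e0 d0; have Fd : F (ball z d) by apply: Fz; exact: nbhsx_ballx.
  have Fe : F (Se e) by exists e.
  have /filter_ex[v [[fv ve] vd]] : F (Se e `&` ball z d) by exact: filterI.
  by exists v; split=> //; move: vd; rewrite -ball_normE.
have c1 : 0 < c + 1 by rewrite ltr_wpDl.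
have fz : f z = 1.
  apply/eqP; rewrite -subr_eq0 -normr_eq0; apply/eqP/le_anti.
  rewrite normr_ge0 andbT; apply/ler_addgt0Pr => e e0; rewrite add0r.
  have [v [fv _ zv]] := near_z 1 (e / (c + 1)) ltr01 (divr_gt0 e0 c1).
  rewrite -fv -linearB (le_trans (fc _))// (@le_trans _ _ ((c + 1) * `|z - v|))//.
    by rewrite ler_wpM2r// lerDl.
  by rewrite mulrC -ler_pdivlMr// ltW.
have zker k : f k = 0 -> '[z, k] = 0.
  move=> fk; have [->|k0] := eqVneq k 0; first by rewrite linear0r.
  have nk0 : 0 < `|k| by rewrite normr_gt0.
  apply/eqP; rewrite -normr_eq0; apply/eqP/le_anti.
  rewrite normr_ge0 andbT; apply/ler_addgt0Pr => e e0; rewrite add0r.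
  have [d d0 ->] : exists2 d : C, 0 < d & e = d * `|k| + d * `|k|.
    by exists (e / 2 / `|k|); rewrite ?divr_gt0// divfK ?gt_eqF// -splitr.
  have [v [fv ve zv]] := near_z (d ^+ 2) d (exprn_gt0 2 d0) d0.
  have vk : `|'[v, k]| <= d * `|k|.
    rewrite -(@ler_pXn2r _ 2) ?nnegrE ?mulr_ge0 ?(ltW d0)// exprMn.
    rewrite -ler_pdivrMr ?exprn_gt0//.
    have := inner_residual v k0; set w' := v - _ => wE.
    have fw : f w' = 1 by rewrite /w' linearB linearZ/= fk mulr0 subr0.
    have -> : `|'[v, k]| ^+ 2 / `|k| ^+ 2 = `|v| ^+ 2 - `|w'| ^+ 2.
      by rewrite wE opprB addrC subrK.
    rewrite lerBlDr (le_trans (ltW ve))// addrC lerD2l.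
    exact: lem.
  rewrite -[z](subrK v) addrC linearDl (le_trans (ler_normD _ _))// lerD//.
  by rewrite (le_trans (inner_CauchySchwarz _ _))// ler_wpM2r// ltW.
have zz : '[z, z] != 0.
  rewrite dnorm_eq0; apply: contra_eq_neq fz => ->.
  by rewrite linear0 eq_sym oner_neq0.
exists ('[z, z]^-1 *: z) => x; rewrite linearZr_LR/= fmorphV/= -innerC.
have := zker (x - f x *: z); rewrite linearB linearZ/= fz mulr1 subrr.
move=> /(_ erefl) zx; have : '[x - f x *: z, z] = 0 by rewrite innerC zx rmorph0.
by rewrite linearBl linearZl_LR/= => /subr0_eq ->; rewrite mulrC mulfK.
Qed.

Lemma bop_bound A : exists2 c : C, 0 <= c & forall x, `|A x| <= c * `|x|.
Proof.
have /linear_boundedP/pinfty_ex_gt0[c /ltW c0 Ac] := bop_bounded A.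
by exists c.
Qed.

Lemma adjoint_exists A :
  exists B : bop H, forall x y, '[A x, y] = '[x, B y].
Proof.
have [c c0 Ac] := bop_bound A.
have /choice[b bE] : forall y, exists z, forall x, '[A x, y] = '[x, z].
  move=> y; pose f x : C := '[A x, y].
  have lf : scalar f by move=> a u v; rewrite /f linearP linearPl.
  pose F : {scalar H} := HB.pack f (GRing.isLinear.Build C H C _ f lf).
  apply: (@riesz F (c * `|y|)); first by rewrite mulr_ge0.
  move=> x; rewrite (le_trans (inner_CauchySchwarz _ _))// mulrAC.
  by rewrite ler_wpM2r.
have b_uniq y z : (forall x, '[A x, y] = '[x, z]) -> b y = z.
  move=> yz; apply/subr0_eq/inner_eq0P => x.
  by rewrite linearBr /= -bE yz subrr.
have lb : linear b.
  move=> a u v; apply: b_uniq => x.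
  by rewrite !linearPr/= !bE.
have bb : bounded_near b (nbhs (0 : H)).
  pose B : {linear H -> H} := HB.pack b (GRing.isLinear.Build C H H _ b lb).
  apply/(linear_boundedP B); near=> r => y /=.
  have bc : `|b y| <= c * `|y|.
    have [->|by0] := eqVneq (b y) 0; first by rewrite normr0 mulr_ge0.
    rewrite -(@ler_pM2l _ `|b y|) ?normr_gt0// -expr2 -inner_norm -bE.
    rewrite -[leLHS]ger0_norm; last by rewrite bE inner_norm exprn_ge0.
    rewrite (le_trans (inner_CauchySchwarz _ _))// mulrA [_ * c]mulrC.
    by rewrite ler_wpM2r.
  rewrite (le_trans bc)// ler_wpM2r//; near: r.
  by apply: nbhs_pinfty_ge; rewrite ger0_real.
by exists (Bop lb bb).
Unshelve. all: by end_near. Qed.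

(* The bounded operator characterized by adjointP and adjoint_unique; the
   default value 0 of xget is never reached, by adjoint_exists. *)
Definition adjoint A : bop H :=
  xget 0 [set B : bop H | forall x y, '[A x, y] = '[x, B y]].

Lemma adjointP A x y : '[A x, y] = '[x, adjoint A y].
Proof. by move: x y; apply: (xgetPex 0 (adjoint_exists A)). Qed.

Lemma adjoint_unique A B : (forall x y, '[A x, y] = '[x, B y]) -> adjoint A = B.
Proof.
move=> AB; apply: bopP => y; apply/subr0_eq/inner_eq0P => x.
by rewrite linearBr /= -adjointP AB subrr.
Qed.

End Adjoint.

Section OperatorClasses.
Variables (R : realType) (H : hilbertType R).
Implicit Types A B M N P : bop H.

Definition opnorm A : R :=
  sup [set complex.Re `|A x| | x in [set x : H | `|x| <= 1]].

Definition op_projection P := P * P = P /\ adjoint P = P.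

(* Nonnegativity in R[i] says that the value is real and nonnegative. *)
Definition op_psd A := forall x : H, 0 <= inner (A x) x.

Definition op_le A B := op_psd (B - A).

Definition classX : set (bop H) := [set M | exists P : bop H,
  [/\ op_projection P, P != 0, P * M * P = M & op_le P (adjoint M * M)]].

Definition nu_op n A : R :=
  inf [set opnorm (A - N) | N in [set N : bop H | N ^+ n = 0]].

End OperatorClasses.

Section Matrices.
Variables (R : realType) (n : nat).
Implicit Types A N Q : 'M[R[i]]_n.

(* The norm that the library puts on matrices is the supremum of the entries,
   hence the explicit Euclidean norm. *)
Definition euclid_norm (x : 'cV[R[i]]_n) : R :=
  Num.sqrt (\sum_i complex.Re `|x i 0| ^+ 2).

Definition mx_opnorm A : R :=
  sup [set euclid_norm (A *m x) |
        x in [set x : 'cV[R[i]]_n | euclid_norm x <= 1]].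

Definition mx_projection Q := Q *m Q = Q /\ Q ^t* = Q.

Definition mx_nilpotent N := exists k : nat, N ^+ k = 0.

Definition nu_mx A : R :=
  inf [set mx_opnorm (A - N) | N in [set N | mx_nilpotent N]].

End Matrices.

(* Main.v *)
Require Import Defs.
From mathcomp Require Import all_boot all_order all_algebra.
From mathcomp Require Import complex ring lra.
From mathcomp Require Import all_classical all_reals all_analysis.

(* Put t = pi / (n + 2) and p k = sin (k t) / (2 cos t sin ((k + 1) t)). Then p
   increases from p 0 = 0 to p n = 1 and p (k + 1) * (1 - p k) has the constant
   value c = 1 / (2 cos t)^2. Both sides are compared with sqrt c.

   Upper bound for nu_mx Q. Let e be the unit vector with squared entries
   p (k + 1) - p k and f_k its truncation to the first k coordinates. The matrix
   N with N f_k = p k f_(k-1) is nilpotent, (e e^T - N) f_k = p k (e - f_(k-1)),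
   and by the choice of p the vectors on the right have c times the Gram matrix
   <f_j, f_k> = p (min j k); so e e^T - N is sqrt c times an isometry. All
   rank-one projections are unitarily equivalent.

   Lower bound for nu_op n M. If N^n = 0 and |M - N|^2 = s c with s < 1, then
   |P x|^2 <= s p_k |x|^2 for x in ker N^k, by induction on k: N x lies in
   ker N^(k-1), hence is at squared distance at least (1 - p_(k-1)) |M x|^2 from
   M x, which lies in the range of P; and |P x| <= |M x|. For k = n and x in the
   range of P this contradicts s < 1. *)

Set Implicit Arguments.
Unset Strict Implicit.
Unset Printing Implicit Defensive.

Import Order.TTheory GRing.Theory Num.Theory.
Import numFieldNormedType.Exports.

Local Open Scope classical_set_scope.
Local Open Scope complex_scope.
Local Open Scope sesquilinear_scope.
Local Open Scope ring_scope.

(** * The trigonometric sequence *)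

(** The two bounds see the sines only through these five properties. For the sequence built below,
    [Num.sqrt c] is half the secant of pi / (n + 2). *)
Definition equalizing (R : realType) n (p : nat -> R) (c : R) :=
  [/\ 0 < c, p 0%N = 0, p n = 1, forall k, (k < n)%N -> p k < p k.+1 &
    forall k, (k < n)%N -> p k.+1 * (1 - p k) = c].

Lemma equalizing_sequence_exists (R : realType) n : (0 < n)%N ->
  exists (p : nat -> R) (c : R), equalizing n p c.
Proof.
move=> n0; pose t : R := pi / n.+2%:R.
have sin_gt0 k : (0 < k < n.+2)%N -> 0 < sin (k%:R * t).
  move=> /andP[k0 kn]; apply: sin_gt0_pi; rewrite /t mulrCA pmulr_rgt0 ?pi_gt0//.
  by rewrite divr_gt0 ?ltr0n//= gtr_pMr ?pi_gt0// ltr_pdivrMr ?ltr0n//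
    mul1r ltr_nat.
(* [0 < n] puts [t] strictly below pi / 2. *)
have ct : 0 < cos t.
  apply: cos_gt0_pihalf; rewrite (@lt_trans _ _ 0) ?oppr_lt0 ?divr_gt0 ?pi_gt0//=.
  by rewrite /t ltr_pM2l ?pi_gt0// ltf_pV2 ?posrE ?ltr0n// ltr_nat !ltnS.
have sinS k :
    sin (k.+1%:R * t) = sin (k%:R * t) * cos t + cos (k%:R * t) * sin t.
  by rewrite -natr1 mulrDl mul1r sinD.
have sinSS k :
    sin (k.+2%:R * t) = 2 * cos t * sin (k.+1%:R * t) - sin (k%:R * t).
  rewrite -!natr1 !mulrDl !mul1r !sinD !cosD.
  by have := sin2cos2 t; rewrite expr2 => st; ring: st.
(* The left side is the numerator of [p k.+1 - p k]; its value shows that [p] increases. *)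
have st k :
    sin (k.+1%:R * t) ^+ 2 - sin (k%:R * t) * sin (k.+2%:R * t) = sin t ^+ 2.
  rewrite sinSS !sinS; have ht := cos2sin2 t; have hkt := cos2sin2 (k%:R * t).
  by ring: ht hkt.
pose p k := sin (k%:R * t) / (2 * cos t * sin (k.+1%:R * t)).
have p1 k : (k < n)%N ->
    1 - p k = sin (k.+2%:R * t) / (2 * cos t * sin (k.+1%:R * t)).
  move=> kn; have s0 : 0 < sin (k.+1%:R * t) by rewrite sin_gt0//= !ltnS ltnW.
  by rewrite sinSS /p; field; rewrite !gt_eqF.
exists p, ((2 * cos t) ^- 2); split.
- by rewrite invr_gt0 exprn_gt0// mulr_gt0.
- by rewrite /p mul0r sin0 mul0r.
- have s0 : 0 < sin (n%:R * t) by rewrite sin_gt0// n0 ltnS leqnSn.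
  (* Since (n + 2) t = pi, the recurrence makes the numerator and denominator of [p n] equal. *)
  rewrite /p; have : sin (n.+2%:R * t) = 0 by rewrite /t mulrCA mulfV ?mulr1 ?sinpi.
  rewrite sinSS => /eqP; rewrite subr_eq0 => /eqP ->.
  by rewrite mulfV// gt_eqF.
- move=> k kn; rewrite -subr_gt0.
  have s1 : 0 < sin (k.+1%:R * t) by rewrite sin_gt0//= !ltnS ltnW.
  have s2 : 0 < sin (k.+2%:R * t) by rewrite sin_gt0//= !ltnS.
  have -> : p k.+1 - p k =
     (sin (k.+1%:R * t) ^+ 2 - sin (k%:R * t) * sin (k.+2%:R * t)) /
     (2 * cos t * sin (k.+1%:R * t) * sin (k.+2%:R * t)).
    by rewrite /p; field; rewrite !gt_eqF.
  rewrite st divr_gt0 ?mulr_gt0//;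
    by have := @sin_gt0 1%N; rewrite mul1r; apply.
- move=> k kn; rewrite p1// /p.
  have s1 : 0 < sin (k.+1%:R * t) by rewrite sin_gt0//= !ltnS ltnW.
  have s2 : 0 < sin (k.+2%:R * t) by rewrite sin_gt0//= !ltnS.
  by field; rewrite !gt_eqF.
Qed.

(** * A nilpotent perturbation of a real rank-one projection *)

(** Each further factor [S] clears one more superdiagonal. *)
Lemma expmx_strict_trig_eq0 (K : pzRingType) n (S : 'M[K]_n) :
  (forall i j : 'I_n, (j <= i)%N -> S i j = 0) -> S ^+ n = 0.
Proof.
move=> S0.
have Sk k : forall i j : 'I_n, (j < i + k)%N -> (S ^+ k) i j = 0.
  elim: k => [|k IH] i j.
    by rewrite addn0 expr0 mxE -val_eqE => /gtn_eqF ->.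
  move=> jik; rewrite exprS mxE big1// => l _.
  have [li|il] := leqP l i; first by rewrite S0// mul0r.
  by rewrite IH ?mulr0// (leq_trans jik)// addnS -addSn leq_add2r.
by apply/matrixP=> i j; rewrite Sk ?mxE// ltn_addl.
Qed.

Lemma expmx_conj (K : comUnitRingType) n (V S : 'M[K]_n) k : V \in unitmx ->
  (V *m S *m invmx V) ^+ k = V *m S ^+ k *m invmx V.
Proof.
move=> Vu; elim: k => [|k IH]; first by rewrite !expr0 mulmx1 mulmxV.
rewrite !exprS IH.
change (V *m S *m invmx V *m (V *m S ^+ k *m invmx V) =
        V *m (S *m S ^+ k) *m invmx V).
by rewrite !mulmxA mulmxKV.
Qed.

Lemma telescope_sumr_ord (K : zmodType) n (p : nat -> K) a b : (a <= b <= n)%N ->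
  \sum_(i < n | (a <= i < b)%N) (p i.+1 - p i) = p b - p a.
Proof.
move=> /andP[ab bn]; rewrite -telescope_sumr// (big_nat_widen _ _ _ _ _ bn).
by rewrite big_geq_mkord; apply: eq_bigl => i; rewrite andbC.
Qed.

(** With N = V S V^-1, the identity [EV] turns the difference into W V^-1, and [WWVV] says that the
    Gram matrix of [W] is [c] times that of [V]. *)
Lemma rank1_sub_nilpotent_isometric (R : realType) n (p : nat -> R) (c : R) :
  equalizing n p c -> exists (e : 'rV[R]_n) (N : 'M[R]_n),
    [/\ e *m e^T = 1%:M, N ^+ n = 0 &
      (e^T *m e - N)^T *m (e^T *m e - N) = c%:M].
Proof.
case=> _ p0 pn pS pc.
pose e : 'rV[R]_n := \row_i Num.sqrt (p i.+1 - p i).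
(* Column k (counted from 0) of V is f_(k+1), that of W is p (k+1) (e - f_k),
   and S is the matrix of the nilpotent in the basis of the columns of V. *)
pose V : 'M[R]_n := \matrix_(i, k) (e 0 i *+ (i <= k)%N).
pose W : 'M[R]_n := \matrix_(i, k) (p k.+1 * e 0 i *+ (k <= i)%N).
pose S : 'M[R]_n := \matrix_(i, k) (p k.+1 *+ (i.+1 == k)).
have ee (i : 'I_n) : e 0 i * e 0 i = p i.+1 - p i.
  by rewrite mxE -expr2 sqr_sqrtr// subr_ge0 ltW// pS.
have sum_lt k : (k <= n)%N -> \sum_(l < n | (l < k)%N) (p l.+1 - p l) = p k.
  by move=> kn; rewrite (@telescope_sumr_ord _ n p 0 k)// p0 subr0.
have sum_ge k : (k <= n)%N -> \sum_(l < n | (k <= l)%N) (p l.+1 - p l) = 1 - p k.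
  move=> kn; rewrite -pn -(@telescope_sumr_ord _ n) ?kn ?leqnn//.
  by apply: eq_bigl => l; rewrite ltn_ord andbT.
have Vu : V \in unitmx.
  rewrite -unitmx_tr unitmxE det_trig; last first.
    by apply/is_trig_mxP => i j ij; rewrite !mxE leqNgt ij mulr0n.
  rewrite unitfE; apply/prodf_neq0 => i _; rewrite !mxE leqnn sqrtr_eq0 -ltNge.
  by rewrite subr_gt0 pS.
have EV : e^T *m e *m V = W + V *m S.
  apply/matrixP => i k; rewrite -mulmxA !mxE big_ord1 !mxE.
  have -> : \sum_j e 0 j * V j k = p k.+1.
    rewrite -sum_lt// [in RHS]big_mkcond.
    apply: eq_bigr => j _; rewrite [V _ _]mxE mulrnAr ee /= ltnS.
    by case: leqP; rewrite ?mulr0n.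
  have -> : \sum_j V i j * S j k = p k.+1 * e 0 i *+ (i < k)%N.
    (* The only nonzero entry in column [k] of [S] is in row k - 1, and [V i j] vanishes for j < i;
       so no term survives when k <= i. *)
    have [ik|ki] := ltnP i k; last first.
      rewrite mulr0n big1// => j _; rewrite !mxE.
      have [ij|] := leqP i j; last by rewrite mulr0n mul0r.
      by rewrite gtn_eqF ?mulr0n ?mulr0// ltnS (leq_trans ki).
    have kn : (k.-1 < n)%N by rewrite (leq_ltn_trans (leq_pred _)).
    have kE : k.-1.+1 = k by rewrite prednK// (leq_ltn_trans _ ik).
    rewrite (bigD1 (Ordinal kn))//= big1 ?addr0.
      by rewrite !mxE /= kE eqxx -ltnS kE ik !mulr1n mulrC.
    move=> j; rewrite -val_eqE /= => jk; rewrite !mxE -kE eqSS (negbTE jk).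
    by rewrite mulr0n mulr0.
  by rewrite !mxE; case: leqP; rewrite ?mulr0n ?mulr1n ?addr0 ?add0r mulrC.
have WWVV : W^T *m W = c *: (V^T *m V).
  (* Gram matrices are symmetric, so j <= k suffices; there the entries are p (j + 1) for [V] and p
     (j + 1) p (k + 1) (1 - p k) for [W]. *)
  have le_case (j k : 'I_n) : (j <= k)%N ->
      (W^T *m W) j k = c * (V^T *m V) j k.
    move=> jk; rewrite !mxE.
    have -> : \sum_l V^T j l * V l k = p j.+1.
      rewrite -sum_lt// [in RHS]big_mkcond; apply: eq_bigr => l _.
      rewrite -ee /= ltnS [V^T _ _]mxE ![V _ _]mxE.
      have [lj|_] := leqP l j; last by rewrite mulr0n mul0r.
      by rewrite (leq_trans lj jk) !mulr1n.
    have -> : \sum_l W^T j l * W l k = p j.+1 * p k.+1 * (1 - p k).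
      rewrite -sum_ge 1?ltnW// [in RHS]big_mkcond mulr_sumr.
      apply: eq_bigr => l _.
      rewrite -ee [W^T _ _]mxE ![W _ _]mxE.
      have [kl|_] := leqP k l; last by rewrite mulr0n !mulr0.
      by rewrite (leq_trans jk kl) !mulr1n; ring.
    by rewrite -mulrA pc// mulrC.
  apply/matrixP => j k; rewrite [RHS]mxE.
  have [jk|/ltnW kj] := leqP j k; first exact: le_case.
  have trE (X : 'M[R]_n) : (X^T *m X) j k = (X^T *m X) k j.
    by rewrite -[in LHS](trmxK X) -trmx_mul mxE trmxK.
  by rewrite !trE le_case.
exists e, (V *m S *m invmx V); split.
- apply/matrixP => i j; rewrite !ord1 !mxE eqxx -pn -(sum_lt n)//.
  by apply: eq_big => [l|l _]; rewrite ?ltn_ord// [e^T _ _]mxE ee.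
- rewrite expmx_conj// expmx_strict_trig_eq0 ?mulmx0 ?mul0mx// => i j ji.
  by rewrite mxE gtn_eqF ?mulr0n.
have -> : e^T *m e - V *m S *m invmx V = W *m invmx V.
  by rewrite -[e^T *m e](mulmxK Vu) EV mulmxDl addrK.
rewrite trmx_mul mulmxA -(mulmxA _ W^T) WWVV -scalemxAr -scalemxAl.
by rewrite mulmxA -trmx_mul mulmxV// trmx1 mul1mx mulmxV// scalemx1.
Qed.

(** * Unitary equivalence of rank-one projections *)

(** Gram-Schmidt on a matrix whose rows all equal a nonzero row of [Q] gives a unitary whose first
    row [b] spans the row space of [Q]; then Q = b* b. *)
Lemma rank1_projection_diag (C : numClosedFieldType) m (Q : 'M[C]_m.+1) :
  Q *m Q = Q -> Q ^t* = Q -> \rank Q = 1%N ->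
  exists2 B : 'M[C]_m.+1, B \is unitarymx & Q = B ^t* *m delta_mx 0 0 *m B.
Proof.
move=> QQ Qh rQ; pose w := nz_row Q; pose A : 'M[C]_m.+1 := \matrix_i w.
exists (schmidt A); first exact: schmidt_unitarymx.
set B := schmidt A; pose b := row 0 B.
have Bu : B \is unitarymx by exact: schmidt_unitarymx.
have w0 : w != 0 by rewrite nz_row_eq0 -mxrank_eq0 rQ.
have wb : (w <= b)%MS.
  have := row_schmidt_sub A 0; rewrite rowK => /submx_trans; apply.
  apply/sumsmx_subP => k; rewrite leqn0 => /eqP k0.
  by rewrite genmxE /b (_ : k = 0)//; apply/val_inj.
have bQ : (b <= Q)%MS.
  apply: submx_trans (nz_row_sub Q).
  by rewrite -(mxrank_leqif_sup wb).2 eqn_leq mxrankS//=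
    (leq_trans (rank_leq_row _))// lt0n mxrank_eq0.
have Qb : (Q <= b)%MS.
  rewrite -(mxrank_leqif_sup bQ).2 rQ eqn_leq rank_leq_row lt0n mxrank_eq0 /=.
  apply/negP => /eqP b0; move: wb; rewrite b0 => /submx0null/eqP.
  by rewrite (negbTE w0).
have bQb : b *m Q = b by have [X ->] := submxP bQ; rewrite -mulmxA QQ.
have bb : b *m b ^t* = 1%:M.
  apply/matrixP => i j; rewrite !ord1 -dotmxE; move/row_unitarymxP: Bu => ->.
  by rewrite mxE.
have QE : Q = b ^t* *m b.
  have [X QX] := submxP Qb; rewrite {1}QX; congr (_ *m _).
  have -> : X = Q *m b ^t* by rewrite QX -mulmxA bb mulmx1.
  by rewrite -{1}Qh -map_mxM -trmx_mul bQb.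
rewrite QE /b rowE trmx_mul map_mxM mulmxA -(mulmxA (B ^t*)).
congr (_ *m _ *m _).
by rewrite trmx_delta map_delta_mx mul_delta_mx.
Qed.

Lemma rank1_projection_unitary_conj (C : numClosedFieldType) n (P Q : 'M[C]_n) :
  P *m P = P -> P ^t* = P -> \rank P = 1%N ->
  Q *m Q = Q -> Q ^t* = Q -> \rank Q = 1%N ->
  exists2 U : 'M[C]_n, U \is unitarymx & Q = U ^t* *m P *m U.
Proof.
case: n P Q => [P Q _ _|n P Q PP Ph rP QQ Qh rQ].
  by rewrite thinmx0 mxrank0.
have [A Au ->] := rank1_projection_diag PP Ph rP.
have [B Bu ->] := rank1_projection_diag QQ Qh rQ.
exists (A ^t* *m B); first by rewrite mul_unitarymx ?trmxC_unitary.
have AA : A *m A ^t* = 1%:M by apply/unitarymxP.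
rewrite trmx_mul map_mxM trmxCK !mulmxA -(mulmxA (B ^t*) A) AA mulmx1.
by rewrite -(mulmxA _ A) AA mulmx1.
Qed.

(** * Upper bound for [nu_mx] *)

Lemma euclid_normE (R : realType) n (x : 'cV[R[i]]_n) :
  (euclid_norm x ^+ 2)%:C = (x ^t* *m x) 0 0.
Proof.
rewrite sqr_sqrtr ?sumr_ge0// => [|i _]; last by rewrite sqr_ge0.
rewrite mxE rmorph_sum; apply: eq_bigr => i _.
rewrite rmorphXn [X in X ^+ _](RRe_real (normr_real (x i 0))).
by rewrite normCKC !mxE.
Qed.

(** Such an [A] multiplies every Euclidean norm by exactly [c]. *)
Lemma mx_opnorm_le (R : realType) n (A : 'M[R[i]]_n) (c : R) : 0 <= c ->
  A ^t* *m A = (c ^+ 2)%:C%:M -> mx_opnorm A <= c.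
Proof.
move=> c0 AA; have Ax x : euclid_norm (A *m x) = c * euclid_norm x.
  apply/eqP; rewrite -(@eqrXn2 _ 2) ?mulr_ge0 ?sqrtr_ge0//; apply/eqP.
  have MC (u v : R) : (u * v)%:C = u%:C * v%:C by exact: rmorphM.
  have CI (u v : R) : u%:C = v%:C -> u = v by case.
  apply: CI; rewrite exprMn [RHS]MC !euclid_normE.
  rewrite trmx_mul map_mxM mulmxA -(mulmxA (x ^t*)) AA mul_mx_scalar.
  by rewrite -scalemxAl mxE.
apply: ge_sup.
  exists (euclid_norm (A *m 0)), 0 => //=.
  by rewrite /euclid_norm big1 ?sqrtr0// => i _; rewrite mxE normr0 /= expr0n.
by move=> _ [x /= x1 <-]; rewrite Ax -[leRHS]mulr1 ler_wpM2l.
Qed.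

Lemma mx_opnorm_ge0 (R : realType) n (A : 'M[R[i]]_n) : 0 <= mx_opnorm A.
Proof.
rewrite /mx_opnorm; set S := [set _ | _ in _].
(* Outside [has_sup], [sup] takes the default value 0. *)
have [hS|hS] := pselect (has_sup S); last by rewrite sup_out.
have [_ [x x1 _]] := hS.1.
apply: le_trans (sqrtr_ge0 _ : 0 <= euclid_norm (A *m x)) _.
by apply: ub_le_sup; [exact: hS.2 | exists x].
Qed.

Lemma nu_mx_le (R : realType) n (Q : 'M[R[i]]_n) (p : nat -> R) (c : R) :
  equalizing n p c -> mx_projection Q -> \rank Q = 1%N -> nu_mx Q <= Num.sqrt c.
Proof.
move=> pc [QQ Qh] rQ; have [c0 _ _ _ _] := pc.
have [e [N [ee Nn EN]]] := rank1_sub_nilpotent_isometric pc.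
pose toC := map_mx (real_complex R).
have toCJ m l (X : 'M[R]_(m, l)) : (toC _ _ X) ^t* = toC _ _ X^T.
  by apply/matrixP => i j; rewrite !mxE; exact: conjc_real.
have toCM m l k (X : 'M[R]_(m, l)) (Y : 'M[R]_(l, k)) :
    toC _ _ (X *m Y) = toC _ _ X *m toC _ _ Y by exact: map_mxM.
have toCX k (X : 'M[R]_n) : toC _ _ X ^+ k = toC _ _ (X ^+ k).
  elim: k => [|k IH]; first by rewrite !expr0 /toC map_mx1.
  by rewrite !exprS IH; exact/esym/toCM.
pose E := toC _ _ (e^T *m e).
have eeC : toC _ _ e *m toC _ _ e^T = 1%:M by rewrite -toCM ee /toC map_mx1.
have [U Uu ->] : exists2 U, U \is unitarymx & Q = U ^t* *m E *m U.
  apply: rank1_projection_unitary_conj => //.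
  - by rewrite /E toCM mulmxA -(mulmxA _ (toC _ _ e)) eeC mulmx1.
  - by rewrite toCJ trmx_mul trmxK.
  - apply/eqP; rewrite eqn_leq /E toCM.
    rewrite (leq_trans (mxrankM_maxl _ _)) ?rank_leq_col//=.
    (* If [E] were 0, then e = e E = 0, against e e^T = 1. *)
    rewrite lt0n mxrank_eq0; apply/eqP => E0.
    have := congr1 (mulmx (toC _ _ e)) E0.
    rewrite mulmxA eeC mul1mx mulmx0 => e0.
    move: eeC; rewrite e0 mul0mx => /matrixP/(_ 0 0)/eqP.
    by rewrite !mxE eq_sym oner_eq0.
have UU : U *m U ^t* = 1%:M by apply/unitarymxP.
have UU' : U ^t* *m U = 1%:M by exact: mulmx1C.
have Ui : invmx U = U ^t* by exact: invmx_unitary.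
pose N' := U ^t* *m toC _ _ N *m U.
apply: (@le_trans _ _ (mx_opnorm (U ^t* *m E *m U - N'))).
  (* The infimum is a true lower bound because operator norms are nonnegative. *)
  apply: ge_inf; first by exists 0 => _ [X _ <-]; exact: mx_opnorm_ge0.
  exists N' => //; exists n.
  have Uu' : U ^t* \in unitmx by rewrite unitarymx_unit ?trmxC_unitary.
  have iU : invmx (U ^t*) = U by rewrite -Ui invmxK.
  by rewrite /N' -{2}iU expmx_conj// toCX Nn /toC map_mx0 mulmx0 mul0mx.
apply: mx_opnorm_le; first exact: sqrtr_ge0.
rewrite /N' -mulmxBl -mulmxBr -[E - _]map_mxB sqr_sqrtr ?ltW//.
rewrite !trmx_mul !map_mxM trmxCK toCJ !mulmxA.
rewrite -(mulmxA _ U) UU mulmx1 -(mulmxA (U ^t*)).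
rewrite -[_ *m toC _ _ _]toCM EN /toC map_scalar_mx.
by rewrite mul_mx_scalar -scalemxAl UU' scalemx1.
Qed.

(** * Lower bound for [nu_op] *)

Lemma norm_RReE (R : realType) (H : hilbertType R)
    (x : H) : `|x| = (complex.Re `|x|)%:C.
Proof. by rewrite RRe_real ?normr_real. Qed.

Lemma Re_norm_ge0 (R : realType) (H : hilbertType R)
    (x : H) : 0 <= complex.Re `|x|.
Proof. rewrite -lecR -norm_RReE; exact: normr_ge0. Qed.

Lemma opnorm_ub (R : realType) (H : hilbertType R)
    (A : bop H) x : complex.Re `|A x| <= opnorm A * complex.Re `|x|.
Proof.
have [c c0 Ac] := bop_bound A.
have cE : c = (complex.Re c)%:C by rewrite RRe_real// ger0_real.
(* Boundedness of [A] makes the supremum in [opnorm] genuine. *)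
have hs : has_sup [set complex.Re `|A x| | x in [set x : H | `|x| <= 1]].
  split; first by exists (complex.Re `|A 0|); by exists 0; rewrite /= ?normr0.
  exists (complex.Re c) => _ [y /= y1 <-].
  rewrite -lecR -norm_RReE -cE (le_trans (Ac y))//.
  by rewrite -[leRHS]mulr1 ler_wpM2l.
have [->|x0] := eqVneq x 0; first by rewrite linear0 normr0 mulr0.
have nx : 0 < complex.Re `|x| by rewrite -ltcR -norm_RReE normr_gt0.
rewrite -ler_pdivrMr//; apply: ub_le_sup; first exact: hs.2.
exists (`|x|^-1 *: x).
  by rewrite /= normrZ normfV normr_id mulVf// normr_eq0.
rewrite linearZ/= normrZ normfV normr_id.
by rewrite [`|x|]norm_RReE [`|A x|]norm_RReE -[(_)^-1]fmorphV -rmorphM /= mulrC.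
Qed.

Lemma proj_inner (R : realType) (H : hilbertType R)
    (P : bop H) x y : op_projection P -> inner (P x) y = inner x (P y).
Proof. by case=> _ PA; rewrite adjointP PA. Qed.

Lemma proj_id (R : realType) (H : hilbertType R)
    (P : bop H) x : op_projection P -> P (P x) = P x.
Proof. by case=> PP _; rewrite -[in RHS]PP. Qed.

(** The quadratic form of M* M - P at [x] is |M x|^2 - |P x|^2. *)
Lemma norm_proj_le (R : realType) (H : hilbertType R)
    (M P : bop H) x : op_le P (adjoint M * M) -> op_projection P ->
  complex.Re `|P x| <= complex.Re `|M x|.
Proof.
move=> /(_ x) MP Pp; rewrite -lecR -!norm_RReE.
rewrite -(@ler_pXn2r _ 2) ?nnegrE// -!inner_norm -subr_ge0.
suff -> : inner (M x) (M x) - inner (P x) (P x) =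
    inner ((adjoint M * M - P) x) x by [].
rewrite (proj_inner _ (P x) Pp) // proj_id//.
rewrite -(proj_inner x x Pp).
have -> : inner (M x) (M x) = inner (adjoint M (M x)) x.
  by rewrite [RHS]innerC -adjointP -innerC.
by rewrite -linearBl.
Qed.

(** As P y = y, Re <y, z> = Re <y, P z> is at most |y| |P z|; expand |y - z|^2 and use the
    inequality of arithmetic and geometric means. *)
Lemma proj_dist (R : realType) (H : hilbertType R)
    (P : bop H) y z (s : R) : op_projection P -> P y = y -> 0 <= s ->
  complex.Re `|P z| ^+ 2 <= s * complex.Re `|z| ^+ 2 ->
  (1 - s) * complex.Re `|y| ^+ 2 <= complex.Re `|y - z| ^+ 2.
Proof.
move=> Pp Py s0.
pose re := complex.Re (inner y z).
have reE : re <= complex.Re `|y| * complex.Re `|P z|.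
  rewrite -lecR rmorphM/= -!norm_RReE /re -{1}Py (proj_inner _ _ Pp).
  apply: le_trans (inner_CauchySchwarz _ _).
  by apply: le_trans (normc_ge_Re _); rewrite lecR ler_norm.
have -> : complex.Re `|y - z| ^+ 2 =
    complex.Re `|y| ^+ 2 - 2 * re + complex.Re `|z| ^+ 2.
  apply: (@complexI R).
  have : `|y - z| ^+ 2 = `|y| ^+ 2 + `|z| ^+ 2 - (inner y z + (inner y z)^*%R).
    by rewrite -!inner_norm dnormB.
  rewrite (norm_RReE (y - z)) (norm_RReE y) (norm_RReE z) -!rmorphXn /=.
  rewrite rmorphD rmorphB rmorphM /re => ->.
  case: (inner y z) => u v; apply/eqP; rewrite eq_complex /=; simpc.
  by rewrite andbT; apply/eqP; ring.
set a := complex.Re `|y| in reE *; set b := complex.Re `|P z| in reE *.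
set d := complex.Re `|z| => bsd.
have a0 : 0 <= a by exact: Re_norm_ge0.
have b0 : 0 <= b by exact: Re_norm_ge0.
have d0 : 0 <= d by exact: Re_norm_ge0.
suff : 2 * (a * b) <= s * a ^+ 2 + d ^+ 2 by nra.
(* Squaring avoids the square root of [s]. *)
rewrite -(@ler_pXn2r _ 2) ?nnegrE ?addr_ge0 ?mulr_ge0 ?sqr_ge0//.
have : a ^+ 2 * b ^+ 2 <= a ^+ 2 * (s * d ^+ 2) by rewrite ler_wpM2l ?sqr_ge0.
by have := sqr_ge0 (s * a ^+ 2 - d ^+ 2); nra.
Qed.

Lemma norm_ker_le (R : realType) (H : hilbertType R)
    n (p : nat -> R) (c t : R) (M N P : bop H) :
  equalizing n p c -> op_projection P -> op_le P (adjoint M * M) ->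
  P * M * P = M -> 0 <= t <= 1 ->
  opnorm (M - N) ^+ 2 <= t * c ->
  forall k x, (k <= n)%N -> (N ^+ k) x = 0 ->
  complex.Re `|P x| ^+ 2 <= t * p k * complex.Re `|x| ^+ 2.
Proof.
move=> [_ p0 pn pS pc] Pp PM PMP /andP[t0 t1] Mc.
have mono k l : (k <= l <= n)%N -> p k <= p l.
  move=> /andP[kl ln]; rewrite -subr_ge0 -telescope_sumr// big_nat_cond.
  apply: sumr_ge0 => i /andP[/andP[_ il] _]; rewrite subr_ge0 ltW// pS//.
  exact: leq_trans il ln.
have p01 k : (k < n)%N -> 0 <= p k < 1.
  move=> kn; have pk1 : p k.+1 <= 1 by rewrite -pn mono// kn leqnn.
  have pk0 : 0 <= p k by rewrite -p0 mono// leq0n ltnW.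
  by rewrite pk0 (lt_le_trans (pS _ kn) pk1).
have PMx x : P (M x) = M x by rewrite -PMP /= proj_id.
elim=> [|k IH] x kn.
  by rewrite expr0 => x0; rewrite (x0 : x = 0) linear0 normr0 /= expr0n/= mulr0.
rewrite exprSr => Nx.
have /andP[pk0 pk1] := p01 _ kn.
have tpk : 0 <= t * p k by rewrite mulr_ge0.
(* The distance bound for y = M x and z = N x, with factor t p_k from the induction hypothesis. *)
have h1 := proj_dist Pp (PMx x) tpk (IH (N x) (ltnW kn) Nx).
have h2 := norm_proj_le x PM Pp.
have h3 : complex.Re `|M x - N x| ^+ 2 <= t * c * complex.Re `|x| ^+ 2.
  have := opnorm_ub (M - N) x.
  rewrite -(@ler_pXn2r _ 2) ?nnegrE ?Re_norm_ge0//; last first.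
    exact: le_trans (Re_norm_ge0 _) (opnorm_ub _ _).
  move=> /le_trans; apply; rewrite exprMn ler_wpM2r//.
  by rewrite sqr_ge0.
(* Since t <= 1, 1 - p k is at most 1 - t p_k. *)
have h4 : (1 - p k) * complex.Re `|P x| ^+ 2 <= t * c * complex.Re `|x| ^+ 2.
  apply: le_trans h3; apply: le_trans h1; apply: ler_pM.
  - by rewrite subr_ge0 ltW.
  - by rewrite sqr_ge0.
  - by rewrite lerD2l lerN2 -[leRHS]mul1r ler_wpM2r.
  - by rewrite ler_pXn2r ?nnegrE ?Re_norm_ge0.
have pk : 0 < 1 - p k by rewrite subr_gt0.
(* Cancel 1 - p k, using c = p (k + 1) (1 - p k). *)
rewrite -(ler_pM2l pk) (_ : _ * (t * _ * _) = t * c * complex.Re `|x| ^+ 2)//.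
by rewrite -(pc _ kn); ring.
Qed.

Lemma nu_op_ge (R : realType) (H : hilbertType R)
    n (M : bop H) (p : nat -> R) (c : R) : (0 < n)%N ->
  equalizing n p c -> classX M -> Num.sqrt c <= nu_op n M.
Proof.
move=> n0 eqp [P [Pp P0 PMP PM]].
have [c0 _ pn _ _] := eqp; apply: lb_le_inf.
  (* [N = 0] shows that the set under the infimum is nonempty, as [0 < n]. *)
  by exists (opnorm (M - 0)), 0 => //=; rewrite expr0n gtn_eqF.
move=> _ [N /= Nn <-]; rewrite leNgt; apply/negP => MNc.
have [y y0] : exists y, P y != 0.
  apply: contrapT => /forallNP Px0; move/eqP: P0; apply; apply: bopP => x.
  by have /negP/negPn/eqP := Px0 x.
have MN0 : 0 <= opnorm (M - N).
  rewrite -(@pmulr_lge0 _ (complex.Re `|P y|)).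
    exact: le_trans (Re_norm_ge0 _) (opnorm_ub _ _).
  by rewrite -ltcR -norm_RReE normr_gt0.
have MNc2 : opnorm (M - N) ^+ 2 < c.
  by rewrite -[ltRHS]sqr_sqrtr ?ltW// ltr_pXn2r ?nnegrE// sqrtr_ge0.
pose t := opnorm (M - N) ^+ 2 / c.
have t01 : 0 <= t <= 1.
  rewrite divr_ge0 ?sqr_ge0 ?(ltW c0)//=.
  by rewrite /t ler_pdivrMr// mul1r ltW.
have tc : opnorm (M - N) ^+ 2 <= t * c by rewrite divfK ?gt_eqF.
have Ny : (N ^+ n) (P y) = 0 by rewrite Nn.
have := norm_ker_le eqp Pp PM PMP t01 tc (leqnn n) Ny.
(* At x = P y the bound reads |P y|^2 <= t |P y|^2, impossible as t < 1 and P y is nonzero. *)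
rewrite proj_id// pn mulr1 leNgt => /negP; apply.
rewrite gtr_pMl ?ltr_pdivrMr ?mul1r// exprn_gt0//.
by rewrite -ltcR -norm_RReE normr_gt0.
Qed.

Theorem theorem6 (R : realType) (n : nat) (H : hilbertType R)
    (Q : 'M[R[i]]_n) (M : bop H) :
  (0 < n)%N ->
  mx_projection Q ->
  \rank Q = 1%N ->
  classX M ->
  nu_mx Q <= nu_op n M.
Proof.
move=> n0 Qp rQ MX; have [p [c pc]] := equalizing_sequence_exists R n0.
exact: le_trans (nu_mx_le pc Qp rQ) (nu_op_ge n0 pc MX).
Qed.
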